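(* Let $D(n)$ be the largest number such that in every arrangement of $n$ lines in the plane in which no six lines are tangent to a common conic, there are $D(n)$ lines of the arrangement such that the triangles formed by triples of these lines have pairwise distinct areas. Then $n^{1/5}<D(n)$.
   Context: A triangle formed by three lines is the triangle bounded by them (three pairwise non-parallel lines; if concurrent the triangle is degenerate of area $0$). The general position hypothesis is that no six lines of the arrangement are tangent to a common (possibly degenerate) conic; in the paper's convention this in particular excludes six lines through a common point and six pairwise parallel lines.
   Formalization: The inequality is stated for n ≥ 2, since for n = 0 and n = 1 one has D(n) = n and the strict inequality n^{1/5} < D(n) fails. *)

(* Defs.v *)
From mathcomp Require Import all_boot all_order all_algebra.
From mathcomp Require Import all_classical all_reals all_analysis.

Set Implicit Arguments.
Unset Strict Implicit.
Unset Printing Implicit Defensive.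

Import Order.TTheory GRing.Theory Num.Theory.

Local Open Scope classical_set_scope.
Local Open Scope ring_scope.

(* Homogeneous coordinates: the affine point (x, y) is (x : y : 1); the row
   vector u = (a, b, c) is the line a x + b y + c z = 0. *)
Definition homog (R : realType) (p : R * R) : 'rV[R]_3 :=
  \row_(i < 3) [:: p.1; p.2; 1]`_i.

Definition incident (R : realType) (P u : 'rV[R]_3) : Prop := P *m u^T = 0.

Definition line_of (R : realType) (u : 'rV[R]_3) : set (R * R) :=
  [set p | incident (homog p) u].

(* Neither zero nor the line at infinity. *)
Definition affine_coords (R : realType) (u : 'rV[R]_3) : Prop :=
  u 0 0 != 0 \/ u 0 1 != 0.

Definition is_line (R : realType) (l : set (R * R)) : Prop :=
  exists2 u : 'rV[R]_3, affine_coords u & l = line_of u.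

(* The projective conic X Q X^T = 0.  Rank 3 is a nondegenerate conic, rank 2 a
   pair of lines (real or complex conjugate).  Rank 1, a double line, is left
   out: every line of the plane meets it with multiplicity two. *)
Definition is_conic (R : realType) (Q : 'M[R]_3) : Prop :=
  Q^T = Q /\ (2 <= \rank Q)%N.

(* [P] is the point of contact: it lies on l, and l lies in its polar.  [P] may
   be at infinity, so the asymptotes of a hyperbola are tangent to it.  For a
   rank 2 conic the tangents are the lines through the common point of its two
   components: a pencil of concurrent lines, or of parallel lines when this
   point is at infinity. *)
Definition tangent (R : realType) (Q : 'M[R]_3) (l : set (R * R)) : Prop :=
  exists u P : 'rV[R]_3,
    [/\ affine_coords u, l = line_of u, P != 0, incident P u &
        forall X : 'rV[R]_3, incident X u -> X *m Q *m P^T = 0].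

Definition line_arrangement (R : realType) (n : nat)
    (L : 'I_n -> set (R * R)) : Prop :=
  injective L /\ forall i, is_line (L i).

Definition no_six_cotangent (R : realType) (n : nat)
    (L : 'I_n -> set (R * R)) : Prop :=
  forall S : {set 'I_n}, #|S| = 6%N ->
    ~ exists2 Q : 'M[R]_3, is_conic Q & forall i, i \in S -> tangent Q (L i).

Definition area (R : realType) (p q r : R * R) : R :=
  `|(q.1 - p.1) * (r.2 - p.2) - (r.1 - p.1) * (q.2 - p.2)| / 2.

(* The three lines form a triangle, of area [a].  Two lines meet in exactly one
   point iff they are not parallel, so the singleton conditions make the lines
   pairwise non-parallel, hence distinct; concurrent lines are allowed and give
   p = q = r and a = 0. *)
Definition triangle_area (R : realType) (l1 l2 l3 : set (R * R)) (a : R) : Prop :=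
  exists p q r : R * R,
    [/\ l2 `&` l3 = [set p], l1 `&` l3 = [set q], l1 `&` l2 = [set r] &
        a = area p q r].

Definition distinct_areas (R : realType) (n : nat) (L : 'I_n -> set (R * R))
    (S : {set 'I_n}) : Prop :=
  forall (i j k i' j' k' : 'I_n) (a a' : R),
    i \in S -> j \in S -> k \in S -> i' \in S -> j' \in S -> k' \in S ->
    triangle_area (L i) (L j) (L k) a ->
    triangle_area (L i') (L j') (L k') a' ->
    [set i; j; k]%SET != [set i'; j'; k']%SET :> {set 'I_n} -> a != a'.

Definition guaranteed (R : realType) (n d : nat) : Prop :=
  forall L : 'I_n -> set (R * R),
    line_arrangement L -> no_six_cotangent L ->
    exists S : {set 'I_n}, #|S| = d /\ distinct_areas L S.

Definition is_largest (A : set nat) (d : nat) : Prop :=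
  A d /\ forall d', A d' -> (d' <= d)%N.

(* The largest guaranteed number; the default value 0 would only be taken if
   there were none. *)
Definition D (R : realType) (n : nat) : nat :=
  xget 0%N [set d | is_largest [set d' | guaranteed R n d'] d].

(* Main.v *)
Require Import Defs.
From mathcomp Require Import all_boot all_order all_algebra.
From mathcomp Require Import all_classical all_reals all_analysis.
(* Imported again so that the lemmas on finite sets shadow those of [classical_sets]. *)
From mathcomp Require Import fintype finset.
From mathcomp Require Import zify ring lra.

(** Write a line as [u = (a, b, c)] and let [[u, v]] be the determinant of the
    first two coordinates.  Lines [a], [b], [l] bound a triangle of area
    [det(a, b, l)^2 / (2 |[a, b] [b, l] [l, a]|)].  For fixed [a] and [b], a fixed
    area and a fixed sign of [[a, l] [b, l]], the line [l] is therefore tangent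
    to one conic having [a] and [b] as asymptotes (the pencil through the common
    point of [a] and [b] when the area is 0).  As [a] and [b] are tangent to it
    too, there are at most three such [l].

    Take all normals in one half-plane.  Then two of the three lines [l] of every
    triangle have [[a, l] [b, l] > 0], where [a] and [b] are the other two, so at
    most [3/2 binom(n-3, 2)] triples disjoint from a triple [T] have the area of
    [T]; the triples meeting [T] are of lower order.  Hence a random [m]-subset
    contains on average at most about [m^6 / (16 n)] unions of two triples of
    equal area.  Removing one line from each leaves more than [n^(1/5)] lines
    when [m] is about [5/4 n^(1/5)].

    That the maximum defining [D] exists needs some arrangement in general
    position: the lines [(1, t, t^3)] with [t = 1, ..., n].  On them a dual conic
    is a polynomial in [t] of degree at most 6 without [t^5], and such a
    polynomial cannot have six distinct positive roots. *)

Set Implicit Arguments.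
Unset Strict Implicit.
Unset Printing Implicit Defensive.

Import Order.TTheory GRing.Theory Num.Theory.
Local Open Scope ring_scope.

(** * Independent sets in hypergraphs *)

Lemma double_counting (A B : finType) (r : A -> B -> bool) (X : {set A}) (Y : {set B})
    (d k : nat) :
  (forall x, x \in X -> d <= #|[set y in Y | r x y]|)%N ->
  (forall y, y \in Y -> #|[set x in X | r x y]| <= k)%N ->
  (d * #|X| <= k * #|Y|)%N.
Proof.
move=> le_d le_k; rewrite ![(_ * #|_|)%N]mulnC -!sum_nat_const.
apply: (@leq_trans (\sum_(x in X) \sum_(y in Y | r x y) 1)).
  by apply: leq_sum => x /le_d; rewrite -sum1dep_card.
rewrite (exchange_big_dep (mem Y)) /= => [|x y _ /andP[]//].
by apply: leq_sum => y yY; rewrite yY sum1dep_card le_k.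
Qed.

Lemma double_sum_imset_le (R : numDomainType) (A B : finType) (P : {set A}) (s : A -> A)
    (f : A -> B) (w : B -> R) :
  (forall x, x \in P -> [/\ s x \in P, s x != x & f (s x) = f x]) ->
  (forall b, 0 <= w b) ->
  2 * \sum_(b in f @: P) w b <= \sum_(x in P) w (f x).
Proof.
move=> symP w0; rewrite mulr_sumr [leRHS](partition_big_imset f).
apply: ler_sum => _ /imsetP[x Px ->]; have [Psx sx_neq fsx] := symP x Px.
rewrite (bigD1 x) ?Px ?eqxx //= (bigD1 (s x)) /= ?Psx ?fsx ?eqxx ?sx_neq //.
rewrite addrA -mulr2n mulr_natl ler_wpDr // sumr_ge0 // => y _; exact: w0.
Qed.

Lemma exists_le_of_ler_sum (R : realDomainType) (I : finType) (P : pred I) (f g : I -> R) :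
  (exists i, P i) -> \sum_(i | P i) f i <= \sum_(i | P i) g i -> exists2 i, P i & f i <= g i.
Proof.
move=> [i0 Pi0] le_sum; apply/exists_inP; move: le_sum; apply: contraTT.
rewrite negb_exists_in => /forall_inP gt_fg; rewrite -ltNge.
apply: ltr_sum => [|i Pi]; first by apply/hasP; exists i0; rewrite ?mem_index_enum.
by rewrite ltNge gt_fg.
Qed.

Lemma ffactnD n j k : (n ^_ (j + k) = n ^_ j * (n - j) ^_ k)%N.
Proof.
elim: k => [|k IHk]; first by rewrite addn0 ffactn0 muln1.
by rewrite addnS !ffactnSr IHk -mulnA subnDA.
Qed.

Lemma bin_sub_ffact n m j :
  (j <= m -> 'C(n - j, m - j) * n ^_ j = 'C(n, m) * m ^_ j)%N.
Proof.
move=> jm; apply/eqP; rewrite -(eqn_pmul2r (fact_gt0 (m - j))); apply/eqP.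
by rewrite mulnAC bin_ffact mulnC -ffactnD subnKC // -mulnA ffact_fact // bin_ffact.
Qed.

Section FiniteSets.
Variable V : finType.
Implicit Types (S T U : {set V}) (F : {set {set V}}) (m : nat).

Lemma exists_subset_card S m : (m <= #|S|)%N -> exists2 T : {set V}, T \subset S & #|T| = m.
Proof.
move=> mS; have: (0 < #|[set T : {set V} | (T \subset S) && (#|T| == m)]|)%N.
  by rewrite cards_draws bin_gt0.
by case/card_gt0P=> T; rewrite inE => /andP[TS /eqP Tm]; exists T.
Qed.

Lemma card_draws_superset U m :
  (#|[set S : {set V} | (U \subset S) && (#|S| == m)]| * #|V| ^_ #|U| = 'C(#|V|, m) * m ^_ #|U|)%N.
Proof.
have [Um|mU] := leqP #|U| m; last first.
  rewrite (ffact_small mU) muln0 (_ : [set _ | _] = set0) ?cards0 //.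
  apply/setP => S; rewrite !inE; apply/negP => /andP[/subset_leq_card US /eqP Sm].
  by rewrite Sm leqNgt mU in US.
rewrite -bin_sub_ffact //; congr (_ * _)%N.
have <- : #|~: U| = (#|V| - #|U|)%N by rewrite -(cardsC U) addKn.
rewrite -cards_draws; set A := [set T : {set V} | (T \subset _) && _].
have addUK : {in A, cancel (fun T => T :|: U) (fun S => S :\: U)}.
  by move=> T; rewrite inE => /andP[TU _]; rewrite setDUl setDv setU0 setDE (setIidPl TU).
rewrite -(card_in_imset (can_in_inj addUK)); congr #|pred_of_set _|.
apply/setP => S; rewrite inE; apply/andP/imsetP => [[US /eqP Sm]|[T + ->]].
  exists (S :\: U); last by rewrite setUC -{1}(setIidPr US) setID.
  by rewrite inE setDE subsetIr -setDE cardsD (setIidPr US) Sm /=.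
rewrite inE => /andP[TU /eqP Tm]; rewrite subsetUr cardsU Tm.
by rewrite disjoint_setI0 ?cards0 ?subn0 ?subnK // disjoints_subset.
Qed.

Lemma exists_independent_subset F S : set0 \notin F ->
  exists2 S' : {set V}, F ::&: S' = set0 & (#|S| <= #|S'| + #|F ::&: S|)%N.
Proof.
move=> F0; have [FS0|[e0]] := set_0Vmem (F ::&: S); first by exists S; rewrite // leq_addr.
rewrite inE => /andP[Fe0 _].
have /set0Pn[v0 _] : e0 != set0 by apply: contraNneq F0 => <-.
pose rep (e : {set V}) := odflt v0 [pick v in e].
have rep_in e : e \in F -> rep e \in e.
  rewrite /rep; case: pickP => [//|e_empty] Fe; case/negP: F0.
  by rewrite (_ : set0 = e) //; apply/setP => v; rewrite inE e_empty.
exists (S :\: (rep @: (F ::&: S))).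
  apply/setP => e; rewrite !inE subsetD; apply/negP => /and3P[Fe eS /pred0P/(_ (rep e))].
  by rewrite /= rep_in // imset_f // inE Fe.
rewrite -[leqLHS](cardsID (rep @: (F ::&: S))) addnC leq_add2l.
exact: leq_trans (subset_leq_card (subsetIr _ _)) (leq_imset_card _ _).
Qed.

Lemma sum_card_ssetI_draws F m : (m <= #|V|)%N ->
  \sum_(S : {set V} | #|S| == m) #|F ::&: S|%:R =
    'C(#|V|, m)%:R * \sum_(e in F) (m ^_ #|e|)%:R / (#|V| ^_ #|e|)%:R :> rat.
Proof.
move=> mV; under eq_bigr do rewrite -sum1dep_card natr_sum.
rewrite (exchange_big_dep (mem F)) /= => [|S e _ /andP[]//].
rewrite mulr_sumr; apply: eq_bigr => e Fe; rewrite Fe /=.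
under eq_bigl do rewrite andbC.
rewrite -natr_sum sum1dep_card mulrA -natrM -card_draws_superset natrM mulfK //.
by rewrite pnatr_eq0 -lt0n ffact_gt0 max_card.
Qed.

Lemma large_independent_set F m : set0 \notin F -> (m <= #|V|)%N ->
  exists2 S : {set V}, F ::&: S = set0 &
    m%:R - \sum_(e in F) (m ^_ #|e|)%:R / (#|V| ^_ #|e|)%:R <= #|S|%:R :> rat.
Proof.
move=> F0 mV; set loss := \sum_(e in F) _.
have [||S0 /eqP S0m le_loss] := @exists_le_of_ler_sum rat _
    (fun S : {set V} => #|S| == m) (fun S => #|F ::&: S|%:R) (fun=> loss).
- by have [|S _ Sm] := @exists_subset_card setT m; [rewrite cardsT | exists S; apply/eqP].
- by rewrite sum_card_ssetI_draws // -card_draws sumr_const mulr_natl cardsE.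
have [S S_ind] := exists_independent_subset S0 F0.
rewrite S0m -(ler_nat rat) natrD => le_m; exists S => //; lra.
Qed.

End FiniteSets.

(** * Conflicting triples *)

Lemma subset_card_setU1 (V : finType) (P T : {set V}) : P \subset T -> #|T| = #|P|.+1 ->
  exists l, T = l |: P.
Proof.
move=> PT cT; have /eqP/cards1P[l El] : #|T :\: P| = 1%N.
  by rewrite cardsD (setIidPr PT) cT subSnn.
by exists l; rewrite -El setUC -{1}(setIidPr PT) setID.
Qed.

Section TripleFamilies.
Variables (V : finType) (G : pred {set V}) (outer : {set V} -> pred V) (k K : nat).
Hypothesis card_G : forall T, G T -> #|T| = 3%N.
Hypothesis two_outer : forall T, G T -> (2 <= #|[set l in T | outer (T :\ l) l]|)%N.
Hypothesis outer_codegree : forall P : {set V}, #|P| = 2%N ->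
  (#|[set l | G (l |: P) && outer P l]| <= k)%N.
Hypothesis codegree : forall P : {set V}, #|P| = 2%N -> (#|[set l | G (l |: P)]| <= K)%N.

Lemma card_triples_through_pair (P : {set V}) : #|P| = 2%N ->
  (#|[set T | G T && (P \subset T)]| <= K)%N.
Proof.
move=> P2; apply: leq_trans (codegree P2).
apply: leq_trans (leq_imset_card (fun l => l |: P) _).
apply/subset_leq_card/subsetP => T; rewrite inE => /andP[GT PT].
have [|l eT] := subset_card_setU1 PT; first by rewrite P2 card_G.
by apply/imsetP; exists l; rewrite // inE -eT.
Qed.

Lemma card_triples_disjoint (U : {set V}) :
  (2 * #|[set T | G T && (#|T :&: U| == 0)]| <= k * 'C(#|~: U|, 2))%N.
Proof.
rewrite -cards_draws.
apply: (double_counting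
  (r := fun T P : {set V} => [exists l in T, (T :\ l == P) && outer P l])) => [T|P].
  rewrite inE cards_eq0 => /andP[GT /eqP TU0]; apply: leq_trans (two_outer GT) _.
  rewrite -(card_in_imset (f := fun l => T :\ l)); last first.
    move=> a b; rewrite !inE => /andP[aT _] /andP[bT _] /setP/(_ a).
    by rewrite !inE eqxx aT; case: eqVneq.
  apply/subset_leq_card/subsetP => _ /imsetP[l + ->]; rewrite inE => /andP[lT out_l].
  rewrite !inE; apply/andP; split; last by apply/exists_inP; exists l; rewrite ?eqxx.
  have /eqP -> : #|T :\ l| == 2%N by rewrite -eqSS -(card_G GT) (cardsD1 l T) lT.
  by rewrite andbT -disjoints_subset (disjointWl (subsetDl _ _)) // -setI_eq0 TU0.
rewrite inE => /andP[_ /eqP P2]; apply: leq_trans (outer_codegree P2).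
apply: leq_trans (leq_imset_card (fun l => l |: P) _).
apply/subset_leq_card/subsetP => T; rewrite !inE => /andP[/andP[GT _]].
case/exists_inP => l lT /andP[/eqP <- out_l]; apply/imsetP; exists l; last by rewrite setD1K.
by rewrite inE setD1K // GT.
Qed.

Lemma card_triples_meeting_once (U : {set V}) :
  (2 * #|[set T | G T && (#|T :&: U| == 1)]| <= K * (#|U| * #|~: U|))%N.
Proof.
rewrite -cardsX.
apply: (double_counting (r := fun (T : {set V}) p => [set p.1; p.2] \subset T)) => [T|[v p]].
  rewrite inE => /andP[GT /cards1P[v Ev]].
  have /andP[vT vU] : (v \in T) && (v \in U) by rewrite -in_setI Ev inE.
  have <- : #|T :\: U| = 2%N by rewrite cardsD card_G // Ev cards1.
  rewrite -(card_imset _ (can_inj (fun p => erefl p : (v, p).2 = p))).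
  apply/subset_leq_card/subsetP => _ /imsetP[p + ->]; rewrite !inE => /andP[pU pT].
  by rewrite vU pU subUset !sub1set vT.
rewrite !inE /= => /andP[vU pU].
have vp : #|[set v; p]| = 2%N by rewrite cards2; case: eqVneq vU pU => // -> ->.
apply: leq_trans (card_triples_through_pair vp).
by apply/subset_leq_card/subsetP => T; rewrite !inE => /andP[/andP[-> _]].
Qed.

Lemma card_triples_meeting_twice (U : {set V}) :
  (#|[set T | G T && (#|T :&: U| == 2)]| <= K * 'C(#|U|, 2))%N.
Proof.
rewrite -cards_draws -[leqLHS]mul1n.
apply: (double_counting (r := fun T P : {set V} => P \subset T)) => [T|P].
  rewrite inE => /andP[_ c2]; apply/card_gt0P; exists (T :&: U).
  by rewrite !inE subsetIr c2 subsetIl.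
rewrite inE => /andP[_ /eqP/card_triples_through_pair]; apply: leq_trans.
by apply/subset_leq_card/subsetP => T; rewrite !inE => /andP[/andP[-> _]].
Qed.

End TripleFamilies.

Definition conflict_free (V : finType) (conflict : rel {set V}) (S : {set V}) : Prop :=
  forall T T' : {set V}, T \subset S -> T' \subset S -> ~~ conflict T T'.

Definition conflict_unions (V : finType) (conflict : rel {set V}) : {set {set V}} :=
  [set p.1 :|: p.2 | p in [set p : {set V} * {set V} | conflict p.1 p.2]].

(* Bounds the expected number of unions of two conflicting triples inside a random [m]-subset of an
   [n]-set; the terms are for unions of 6, 5 and 4 elements. *)
Definition conflict_loss (k K n m : nat) : rat :=
  k%:R / 48 * ((m ^_ 6)%:R / (n - 5)%:R) + K%:R / 8 * ((m ^_ 5)%:R / (n - 4)%:R)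
    + K%:R / 4 * ((m ^_ 4)%:R / (n - 3)%:R).

Lemma ffact_ratioS_le (n m j : nat) :
  (n ^_ j)%:R * ((m ^_ j.+1)%:R / (n ^_ j.+1)%:R) <= (m ^_ j.+1)%:R / (n - j)%:R :> rat.
Proof.
rewrite [(n ^_ j.+1)%N]ffactnSr natrM invfM.
have [->|nj0] := eqVneq (n ^_ j)%:R (0 : rat); first by rewrite mul0r divr_ge0.
by rewrite mulrCA mulVKf.
Qed.

Lemma card_setI_lt (V : finType) (T T' : {set V}) :
  #|T| = #|T'| -> T != T' -> (#|T' :&: T| < #|T'|)%N.
Proof.
move=> cT; rewrite eq_sym; apply: contraNltn => le_I.
have T'T : T' \subset T by apply/setIidPl/eqP; rewrite eqEcard subsetIl.
by rewrite eqEcard T'T cT /=.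
Qed.

Section ConflictingTriples.
Variables (V : finType) (conflict : rel {set V}) (outer : {set V} -> pred V) (k K : nat).
Hypothesis conflict_sym : symmetric conflict.
Hypothesis conflict_irr : irreflexive conflict.
Hypothesis card_conflict : forall T T', conflict T T' -> #|T'| = 3%N.
Hypothesis two_outer : forall T T', conflict T T' ->
  (2 <= #|[set l in T' | outer (T' :\ l) l]|)%N.
Hypothesis outer_codegree : forall T P : {set V}, #|P| = 2%N ->
  (#|[set l | conflict T (l |: P) && outer P l]| <= k)%N.
Hypothesis codegree : forall T P : {set V}, #|P| = 2%N ->
  (#|[set l | conflict T (l |: P)]| <= K)%N.

Implicit Types (T S : {set V}) (w : nat -> rat) (m : nat).

Local Notation n := #|V|.

Lemma sum_conflicts_by_intersection T w : #|T| = 3%N ->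
  \sum_(T' | conflict T T') w #|T :|: T'| =
    \sum_(i < 3) #|[set T' | conflict T T' && (#|T' :&: T| == i)]|%:R * w (6 - i)%N.
Proof.
move=> T3; under [RHS]eq_bigr do rewrite mulr_natl -sumr_const.
rewrite (exchange_big_dep (conflict T)) /= => [|i T' _]; last by rewrite !inE => /andP[].
apply: eq_bigr => T' TT'; have T'3 := card_conflict TT'.
have ltI : (#|T' :&: T| < 3)%N.
  rewrite -T'3 card_setI_lt ?T3 ?T'3 //.
  by apply: contraTneq TT' => ->; rewrite conflict_irr.
rewrite (big_pred1 (Ordinal ltI)) => [|i]; last by rewrite !inE TT' eq_sym.
by rewrite cardsU T3 T'3 setIC.
Qed.

Lemma sum_conflicts_le T w : (forall j, 0 <= w j) -> #|T| = 3%N ->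
  \sum_(T' | conflict T T') w #|T :|: T'| <=
    k%:R / 4 * ((n - 3) * (n - 4))%:R * w 6%N + K%:R * 3 / 2 * (n - 3)%:R * w 5%N
      + K%:R * 3 * w 4%N.
Proof.
move=> w0 T3; rewrite sum_conflicts_by_intersection // !big_ord_recr big_ord0 /= add0r.
have cT : #|~: T| = (n - 3)%N by rewrite -T3 -(cardsC T) addKn.
have le_disjoint : #|[set T' | conflict T T' && (#|T' :&: T| == 0)]|%:R
    <= k%:R / 4 * ((n - 3) * (n - 4))%:R :> rat.
  have := card_triples_disjoint (@card_conflict T) (@two_outer T) (@outer_codegree T) T.
  have : ('C(n - 3, 2) * 2 = (n - 3) * (n - 4))%N by rewrite bin_ffact ffactnS ffactn1 -subnS.
  rewrite cT; move: (_ * (n - 4))%N => p <-; rewrite -(ler_nat rat) !natrM; lra.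
have le_once : #|[set T' | conflict T T' && (#|T' :&: T| == 1)]|%:R
    <= K%:R * 3 / 2 * (n - 3)%:R :> rat.
  have := card_triples_meeting_once (@card_conflict T) (@codegree T) T.
  rewrite cT T3 -(ler_nat rat) !natrM; lra.
have le_twice : #|[set T' | conflict T T' && (#|T' :&: T| == 2)]|%:R <= K%:R * 3 :> rat.
  have := card_triples_meeting_twice (@card_conflict T) (@codegree T) T.
  by rewrite T3 -(ler_nat rat) natrM.
by rewrite !lerD ?ler_wpM2r.
Qed.

Lemma sum_conflict_unions_le m :
  \sum_(e in conflict_unions conflict) (m ^_ #|e|)%:R / (n ^_ #|e|)%:R <= conflict_loss k K n m.
Proof.
pose w j : rat := (m ^_ j)%:R / (n ^_ j)%:R.
have w0 j : 0 <= w j by exact: divr_ge0.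
have le_double : 2 * \sum_(e in conflict_unions conflict) w #|e| <=
    \sum_(T : {set V} | #|T| == 3%N) \sum_(T' | conflict T T') w #|T :|: T'|.
  apply: le_trans (double_sum_imset_le (s := fun p => (p.2, p.1)) _ _) _ => //=.
    move=> [T T']; rewrite !inE /= => TT'; split; rewrite 1?conflict_sym 1?setUC //.
    by apply: contraTneq TT' => -[->]; rewrite conflict_irr.
  under eq_bigl do rewrite inE.
  rewrite -(pair_big_dep xpredT conflict (fun T T' => w #|T :|: T'|)) /= [leRHS]big_mkcond.
  apply: ler_sum => T _; case: ifPn => // T3; rewrite big1 // => T'.
  by rewrite conflict_sym => /card_conflict/eqP; rewrite (negPf T3).
have : 2 * \sum_(e in conflict_unions conflict) w #|e| <= 'C(n, 3)%:R *
    (k%:R / 4 * ((n - 3) * (n - 4))%:R * w 6%N + K%:R * 3 / 2 * (n - 3)%:R * w 5%N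
      + K%:R * 3 * w 4%N).
  apply: le_trans le_double _; rewrite -card_draws cardsE mulr_natl -sumr_const.
  by apply: ler_sum => T /eqP; exact: sum_conflicts_le.
have loss_term (c : rat) j : 0 <= c ->
    c * ((n ^_ j)%:R * w j.+1) <= c * ((m ^_ j.+1)%:R / (n - j)%:R).
  by move=> c0; rewrite ler_wpM2l // ffact_ratioS_le.
have := loss_term (k%:R / 48) 5%N (divr_ge0 (ler0n _ _) (ler0n _ _)).
have := loss_term (K%:R / 8) 4%N (divr_ge0 (ler0n _ _) (ler0n _ _)).
have := loss_term (K%:R / 4) 3%N (divr_ge0 (ler0n _ _) (ler0n _ _)).
have n3 : (n ^_ 3)%:R = 6 * 'C(n, 3)%:R :> rat by rewrite -bin_ffact natrM mulrC.
have nS j : (n ^_ j.+1)%:R = (n ^_ j)%:R * (n - j)%:R :> rat by rewrite ffactnSr natrM.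
rewrite (nS 4%N) (nS 3%N) n3 natrM /conflict_loss.
lra.
Qed.

Lemma large_conflict_free_set m : (m <= n)%N ->
  exists2 S, conflict_free conflict S & m%:R - conflict_loss k K n m <= #|S|%:R.
Proof.
have F0 : set0 \notin conflict_unions conflict.
  apply/imsetP => -[[T T']]; rewrite inE /= => /card_conflict T'3 /esym/eqP.
  by rewrite setU_eq0 => /andP[_ /eqP T'0]; rewrite T'0 cards0 in T'3.
move=> mn; have [S indS le_S] := large_independent_set F0 mn.
exists S; last by apply: le_trans le_S; rewrite lerB // sum_conflict_unions_le.
move=> T T' TS T'S; apply/negP => TT'; have := in_set0 (T :|: T').
rewrite -indS inE subUset TS T'S !andbT => /negbT/negP[].
by apply/imsetP; exists (T, T'); rewrite ?inE.
Qed.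

End ConflictingTriples.

(* As [5/4 - (5/4)^6 / 16 > 1], the choice [m = ceil (5/4 N)] works. *)
Lemma exists_sample_size_nat (N : nat) : (3 <= N)%N -> exists m, [/\ (N < m)%N, (m <= N ^ 5)%N &
  (m ^_ 6 + 12 * m ^_ 5 + 24 * m ^_ 4 < 16 * (N ^ 5 - 5) * (m - N))%N].
Proof.
move=> N3; have [->|N4] := eqVneq N 3%N; first by exists 4%N.
have [t [r [-> r4]]] : exists t r, (N = 4 * t + 4 + r /\ r < 4)%N.
  exists (N %/ 4 - 1)%N, (N %% 4)%N.
  by have := divn_eq N 4; have := ltn_pmod N (isT : 0 < 4)%N; lia.
exists (5 * t + 5 + r + (0 < r))%N; rewrite !ffactnSr ffactn0 !expnS expn0.
have [t2_ge0 t3_ge0 t4_ge0 t5_ge0 t6_ge0] : [/\ 0 <= t * t, 0 <= t * t * t, 0 <= t * t * t * t,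
    0 <= t * t * t * t * t & 0 <= t * t * t * t * t * t]%N by [].
by case: r r4 => [|[|[|[|]]]] // _ /=; split; lia.
Qed.

Lemma exists_sample_size (N n : nat) : (N < n)%N -> (N ^ 5 <= n)%N ->
  exists2 m, (m <= n)%N & N%:R < m%:R - conflict_loss 3 6 n m.
Proof.
move=> Nn N5n; have [N2|N3] := leqP N 2.
  exists N.+1; rewrite // /conflict_loss !ffact_small ?ltnS ?(leq_trans N2) //.
  by rewrite !mul0r !mulr0 !addr0 ltr_nat.
have [m [Nm mN5 le_m]] := exists_sample_size_nat N3.
exists m; first exact: leq_trans N5n.
have d_gt0 : (0 < N ^ 5 - 5)%N by move: le_m; case: (_ - 5)%N => //; rewrite muln0.
pose d : rat := (N ^ 5 - 5)%:R.
have div_le (c : nat) j : (j <= 5)%N -> c%:R / (n - j)%:R <= c%:R / d.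
  move=> j5; have le_d : (N ^ 5 - 5 <= n - j)%N by apply: leq_sub.
  by rewrite ler_wpM2l // lef_pV2 ?ler_nat // posrE ltr0n ?(leq_trans d_gt0).
have lt_sum x y z : (x + 12 * y + 24 * z < 16 * (N ^ 5 - 5) * (m - N))%N ->
    x%:R / d + 12 * (y%:R / d) + 24 * (z%:R / d) < 16 * (m%:R - N%:R).
  rewrite -(ltr_nat rat) !natrD !natrM (natrB _ (ltnW Nm)) -/d => lt_xyz.
  suff : (x%:R + 12 * y%:R + 24 * z%:R) / d < 16 * (m%:R - N%:R) by lra.
  have d0 : 0 < d by rewrite ltr0n.
  rewrite (ltr_pdivrMr _ _ d0); lra.
have := lt_sum _ _ _ le_m.
have := (div_le (m ^_ 6) 5%N isT, div_le (m ^_ 5) 4%N isT, div_le (m ^_ 4) 3%N isT).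
case=> -[]; rewrite /conflict_loss; lra.
Qed.

(** * Triangles and hyperbolas in homogeneous coordinates *)

Lemma ord3P (i : 'I_3) : [\/ i = 0, i = 1 | i = 2].
Proof.
by case: i => [[|[|[|//]]] h]; [constructor 1|constructor 2|constructor 3]; apply/val_inj.
Qed.

Lemma big_ord3 (R : nmodType) (F : 'I_3 -> R) : \sum_i F i = F 0 + F 1 + F 2.
Proof.
rewrite !big_ord_recl big_ord0 addr0 addrA.
by congr (F _ + F _ + F _); apply/val_inj.
Qed.

Definition minor2 (R : pzRingType) (m n : nat) (A : 'M[R]_(m, n)) i j k l : R :=
  A i k * A j l - A i l * A j k.

Lemma mxrank_le1P (F : fieldType) (m n : nat) (A : 'M[F]_(m, n)) :
  reflect (forall i j k l, minor2 A i j k l = 0) (\rank A <= 1)%N.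
Proof.
apply: (iffP idP) => [rA i j k l|minors0].
  rewrite /minor2 -(mulmx_base A); move: (col_base A) (row_base A) rA.
  by case: (\rank A) => [|[|//]] B C _; rewrite !mxE ?big_ord0 ?big_ord1; ring.
have [->|/matrix0Pn[i [k Aik]]] := eqVneq A 0; first by rewrite mxrank0.
have -> : A = col k A *m ((A i k)^-1 *: row i A); last exact: mulmx_max_rank.
apply/matrixP => j l; rewrite !mxE big_ord1 !mxE; apply: (mulfI Aik).
by rewrite (subr0_eq (minors0 i j k l)) mulrCA mulVKf // mulrC.
Qed.

Section DotProduct.
Variables (R : comNzRingType) (n : nat).
Implicit Types (c : R) (u v w : 'rV[R]_n).

Definition dot u v : R := (u *m v^T) 0 0.

Lemma dotC u v : dot u v = dot v u.
Proof. by rewrite /dot !mxE; apply: eq_bigr => i _; rewrite !mxE mulrC. Qed.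

Lemma dotDl u v w : dot (u + v) w = dot u w + dot v w.
Proof. by rewrite /dot mulmxDl mxE. Qed.

Lemma dotZl c u v : dot (c *: u) v = c * dot u v.
Proof. by rewrite /dot -scalemxAl mxE. Qed.

Lemma dotZr c u v : dot u (c *: v) = c * dot u v.
Proof. by rewrite dotC dotZl dotC. Qed.

End DotProduct.

Section HomogeneousCoordinates.
Variable R : comNzRingType.
Implicit Types (x y z : R) (u v w X : 'rV[R]_3).

Definition row3 x y z : 'rV[R]_3 := \row_(i < 3) [:: x; y; z]`_i.

Definition bracket u v : R := u 0 0 * v 0 1 - u 0 1 * v 0 0.

Definition cross u v : 'rV[R]_3 :=
  row3 (u 0 1 * v 0 2 - u 0 2 * v 0 1) (u 0 2 * v 0 0 - u 0 0 * v 0 2) (bracket u v).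

Definition det3 u v w : R := dot (cross u v) w.

Lemma row3E x y z :
  ((row3 x y z 0 0 = x) * (row3 x y z 0 1 = y) * (row3 x y z 0 2 = z))%type.
Proof. by rewrite !mxE. Qed.

Lemma eq_row3 u v : u 0 0 = v 0 0 -> u 0 1 = v 0 1 -> u 0 2 = v 0 2 -> u = v.
Proof. by move=> e0 e1 e2; apply/rowP => i; case: (ord3P i) => ->. Qed.

Lemma dot3E u v : dot u v = u 0 0 * v 0 0 + u 0 1 * v 0 1 + u 0 2 * v 0 2.
Proof. by rewrite /dot mxE big_ord3 !mxE. Qed.

Lemma bracketC u v : bracket v u = - bracket u v.
Proof. by rewrite /bracket; ring. Qed.

Lemma bracketxx u : bracket u u = 0.
Proof. by rewrite /bracket; ring. Qed.

Lemma dot_crossl u v : dot (cross u v) u = 0.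
Proof. by rewrite dot3E !row3E /bracket; ring. Qed.

Lemma dot_crossr u v : dot (cross u v) v = 0.
Proof. by rewrite dot3E !row3E /bracket; ring. Qed.

Lemma det3C12 u v w : det3 v u w = - det3 u v w.
Proof. by rewrite /det3 !dot3E !row3E /bracket; ring. Qed.

Lemma det3C23 u v w : det3 u w v = - det3 u v w.
Proof. by rewrite /det3 !dot3E !row3E /bracket; ring. Qed.

Lemma det3Z x y z u v w : det3 (x *: u) (y *: v) (z *: w) = x * y * z * det3 u v w.
Proof. by rewrite /det3 !dot3E !row3E /bracket !mxE; ring. Qed.

Lemma det3_cross u v w : det3 (cross v w) (cross w u) (cross u v) = det3 u v w ^+ 2.
Proof. by rewrite /det3 !dot3E !row3E /bracket !row3E /bracket; ring. Qed.

Lemma cramer_bracket u v w :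
  bracket v w *: u + bracket w u *: v + bracket u v *: w = row3 0 0 (det3 u v w).
Proof. by apply: eq_row3; rewrite row3E !mxE /det3 ?dot3E ?row3E /bracket; ring. Qed.

Lemma bracket_scale_cross X u v : dot X u = 0 -> dot X v = 0 ->
  bracket u v *: X = X 0 2 *: cross u v.
Proof.
move=> Xu Xv; apply/subr0_eq.
transitivity (row3 (v 0 1 * dot X u - u 0 1 * dot X v) (u 0 0 * dot X v - v 0 0 * dot X u) 0).
  by apply: eq_row3; rewrite row3E !mxE ?dot3E /bracket /=; ring.
by rewrite Xu Xv !mulr0 subrr; apply: eq_row3; rewrite !mxE.
Qed.

End HomogeneousCoordinates.

Section Lines.
Variable R : realType.
Implicit Types (c : R) (u v w X P : 'rV[R]_3) (p q r : R * R).

Lemma incidentP P u : incident P u <-> dot P u = 0.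
Proof.
rewrite /incident /dot; split=> [->|Pu0]; first by rewrite mxE.
by apply/matrixP => i j; rewrite !ord1 Pu0 mxE.
Qed.

Lemma line_ofP u p : line_of u p <-> dot (homog p) u = 0.
Proof. exact: incidentP. Qed.

Lemma line_ofZ c u : c != 0 -> line_of (c *: u) = line_of u.
Proof.
move=> c0; apply/seteqP; split=> p /line_ofP.
  by rewrite dotZr => /eqP; rewrite mulf_eq0 (negPf c0) => /eqP/line_ofP.
by move=> pu; apply/line_ofP; rewrite dotZr pu mulr0.
Qed.

Lemma line_of_eq_scale u v : affine_coords u -> line_of u = line_of v -> exists c, v = c *: u.
Proof.
move=> u_aff uv.
have on_v x y : x * u 0 0 + y * u 0 1 + u 0 2 = 0 -> x * v 0 0 + y * v 0 1 + v 0 2 = 0.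
  move=> xy; have : line_of v (x, y) by rewrite -uv; apply/line_ofP; rewrite dot3E !row3E mul1r.
  by move/line_ofP; rewrite dot3E !row3E mul1r.
case: u_aff => [u0|u1].
  have v2 : - u 0 2 / u 0 0 * v 0 0 + 0 * v 0 1 + v 0 2 = 0.
    by apply: on_v; rewrite divfK //; ring.
  have v1 : (- u 0 2 - u 0 1) / u 0 0 * v 0 0 + 1 * v 0 1 + v 0 2 = 0.
    by apply: on_v; rewrite divfK //; ring.
  by exists (v 0 0 / u 0 0); apply: eq_row3; rewrite mxE ?divfK //; lra.
have v2 : 0 * v 0 0 + - u 0 2 / u 0 1 * v 0 1 + v 0 2 = 0.
  by apply: on_v; rewrite divfK //; ring.
have v0 : 1 * v 0 0 + (- u 0 2 - u 0 0) / u 0 1 * v 0 1 + v 0 2 = 0.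
  by apply: on_v; rewrite divfK //; ring.
by exists (v 0 1 / u 0 1); apply: eq_row3; rewrite mxE ?divfK //; lra.
Qed.

Lemma affine_coordsZ c u : affine_coords (c *: u) -> c != 0.
Proof. by rewrite /affine_coords !mxE !mulf_eq0 !negb_or => -[] /andP[]. Qed.

Lemma tangentP (Q : 'M[R]_3) u : affine_coords u ->
  tangent Q (line_of u) <-> exists P : 'rV[R]_3,
    [/\ P != 0, dot P u = 0 & forall X : 'rV[R]_3, dot X u = 0 -> dot (X *m Q) P = 0].
Proof.
move=> u_aff; split=> [[v [P [v_aff uv P0 /incidentP Pv vP]]]|[P [P0 Pu uP]]].
  have [c ev] := line_of_eq_scale u_aff uv; rewrite ev in v_aff Pv vP.
  have c0 := affine_coordsZ v_aff.
  exists P; split=> // [|X Xu]; first by apply: (mulfI c0); rewrite -dotZr Pv mulr0.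
  by apply/incidentP/vP/incidentP; rewrite dotZr Xu mulr0.
exists u, P; split=> //; first exact/incidentP.
by move=> X /incidentP/uP/incidentP.
Qed.

Definition pairwise_nonparallel u v w : bool :=
  [&& bracket u v != 0, bracket v w != 0 & bracket w u != 0].

Definition area_of_lines u v w : R :=
  det3 u v w ^+ 2 / (2 * `|bracket u v * bracket v w * bracket w u|).

Lemma pairwise_nonparallelC12 u v w : pairwise_nonparallel v u w = pairwise_nonparallel u v w.
Proof.
rewrite /pairwise_nonparallel (bracketC u v) (bracketC u w) (bracketC v w) !oppr_eq0.
by congr (_ && _); rewrite andbC.
Qed.

Lemma pairwise_nonparallelC23 u v w : pairwise_nonparallel u w v = pairwise_nonparallel u v w.
Proof.
rewrite /pairwise_nonparallel (bracketC w u) (bracketC v w) (bracketC u v) !oppr_eq0.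
by rewrite andbC -andbA andbCA.
Qed.

Lemma area_of_linesC12 u v w : area_of_lines v u w = area_of_lines u v w.
Proof.
rewrite /area_of_lines det3C12 sqrrN (bracketC u v) (bracketC v w) (bracketC w u).
by rewrite mulrNN mulrN normrN [X in `|X|]mulrAC.
Qed.

Lemma area_of_linesC23 u v w : area_of_lines u w v = area_of_lines u v w.
Proof.
rewrite /area_of_lines det3C23 sqrrN (bracketC v w) (bracketC u v) (bracketC w u).
by rewrite mulrNN mulrN normrN; congr (_ / (2 * `|_|)); ring.
Qed.

Lemma bracket_neq0_of_meet u v p :
  affine_coords u -> (line_of u `&` line_of v)%classic = [set p]%classic -> bracket u v != 0.
Proof.
move=> u_aff uv; apply/eqP => uv0; have : (line_of u `&` line_of v)%classic p by rewrite uv.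
case=> /line_ofP pu /line_ofP pv.
have : (line_of u `&` line_of v)%classic (p.1 - u 0 1, p.2 + u 0 0).
  split; apply/line_ofP; rewrite dot3E !row3E /=.
    by rewrite -pu dot3E !row3E; ring.
  by rewrite -pv -[RHS]addr0 -uv0 dot3E !row3E /bracket; ring.
rewrite uv; case: p {uv pu pv} => x y /= [e1 e0].
have [u0 u1] : u 0 0 = 0 /\ u 0 1 = 0 by split; lra.
by case: u_aff; rewrite ?u0 ?u1 eqxx.
Qed.

Lemma homog_meet u v p : bracket u v != 0 -> line_of u p -> line_of v p ->
  homog p = (bracket u v)^-1 *: cross u v.
Proof.
move=> uv0 /line_ofP pu /line_ofP pv; have := bracket_scale_cross pu pv.
by rewrite row3E scale1r => <-; rewrite scalerA mulVf // scale1r.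
Qed.

Lemma area_homog p q r : area p q r = `|det3 (homog p) (homog q) (homog r)| / 2.
Proof. by rewrite /area /det3 !dot3E !row3E /bracket !row3E; congr (`|_| / 2); ring. Qed.

Lemma triangle_area_of_lines u v w (a : R) :
  affine_coords u -> affine_coords v -> affine_coords w ->
  triangle_area (line_of u) (line_of v) (line_of w) a ->
  pairwise_nonparallel u v w /\ a = area_of_lines u v w.
Proof.
move=> u_aff v_aff w_aff [p [q [r [vw uw uv ->]]]]; rewrite classical_sets.setIC in uw.
have [pv pw] : (line_of v `&` line_of w)%classic p by rewrite vw.
have [qw qu] : (line_of w `&` line_of u)%classic q by rewrite uw.
have [ru rv] : (line_of u `&` line_of v)%classic r by rewrite uv.
have uv0 := bracket_neq0_of_meet u_aff uv; have vw0 := bracket_neq0_of_meet v_aff vw.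
have wu0 := bracket_neq0_of_meet w_aff uw.
split; first exact/and3P.
rewrite area_homog (homog_meet vw0) // (homog_meet wu0) // (homog_meet uv0) //.
rewrite det3Z det3_cross -!invfM [bracket v w * _ * _]mulrC [bracket u v * (_ * _)]mulrA.
by rewrite normrM normfV (ger0_norm (sqr_ge0 _)) /area_of_lines invfM; ring.
Qed.

(* The conic [2 (u . X) (v . X) = c z^2], with asymptotes [u] and [v]. *)
Definition hyperbola u v c : 'M[R]_3 :=
  u^T *m v + v^T *m u - c *: delta_mx 2 2.

Lemma hyperbolaC u v c : hyperbola u v c = hyperbola v u c.
Proof. by rewrite /hyperbola [v^T *m u + _]addrC. Qed.

Lemma hyperbolaE u v c (i j : 'I_3) :
  hyperbola u v c i j = u 0 i * v 0 j + v 0 i * u 0 j - c * ((i == 2) && (j == 2))%:R.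
Proof. by rewrite !mxE !big_ord1 !mxE. Qed.

Lemma dot_hyperbola u v c X P :
  dot (X *m hyperbola u v c) P =
    dot X u * dot v P + dot X v * dot u P - c * X 0 2 * P 0 2.
Proof. rewrite !dot3E !mxE !big_ord3 !hyperbolaE /=; ring. Qed.

Lemma hyperbola_conic u v c : bracket u v != 0 -> is_conic (hyperbola u v c).
Proof.
move=> uv0; split; first by apply/matrixP => i j; rewrite mxE !hyperbolaE andbC; ring.
rewrite ltnNge; apply: contra_neqN uv0 => /mxrank_le1P/(_ 0 1 0 1).
rewrite /minor2 !hyperbolaE /= => minor0; apply/eqP; rewrite -sqrf_eq0; apply/eqP.
by rewrite /bracket; lra.
Qed.

Lemma tangent_asymptote u v c : affine_coords u -> tangent (hyperbola u v c) (line_of u).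
Proof.
move=> u_aff; apply/tangentP => //; exists (row3 (u 0 1) (- u 0 0) 0); split.
- apply/eqP => /rowP P0; have := (P0 0, P0 1); rewrite !row3E !mxE => -[u1 /eqP].
  by rewrite oppr_eq0 => /eqP u0; case: u_aff; rewrite ?u0 ?u1 eqxx.
- by rewrite dot3E !row3E; ring.
- move=> X Xu; rewrite dot_hyperbola Xu; suff -> : dot u (row3 (u 0 1) (- u 0 0) 0) = 0.
    by rewrite row3E; ring.
  by rewrite dot3E !row3E; ring.
Qed.

Definition touching_level u v w : R :=
  - det3 u v w ^+ 2 / (2 * (bracket u w * bracket v w)).

(* The point of contact is the midpoint of the intersections with the asymptotes. *)
Lemma tangent_hyperbola u v w :
  affine_coords w -> bracket u w != 0 -> bracket v w != 0 ->
  tangent (hyperbola u v (touching_level u v w)) (line_of w).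
Proof.
move=> w_aff uw vw; apply/tangentP => //.
pose P := (bracket u w)^-1 *: cross u w + (bracket v w)^-1 *: cross v w.
have P2 : P 0 2 = 2 by rewrite !mxE /= !mulVf.
have Pu : dot u P = det3 u v w / bracket v w.
  rewrite dotC dotDl !dotZl dot_crossl mulr0 add0r -/(det3 v w u).
  by rewrite det3C23 det3C12 opprK mulrC.
have Pv : dot v P = - det3 u v w / bracket u w.
  by rewrite dotC dotDl !dotZl dot_crossl mulr0 addr0 -/(det3 u w v) det3C23 mulrC.
exists P; split.
- by apply/eqP => P0; move/eqP: P2; rewrite P0 mxE eq_sym pnatr_eq0.
- by rewrite dotDl !dotZl !dot_crossr !mulr0 addr0.
move=> X Xw; rewrite dot_hyperbola Pu Pv P2 /touching_level.
have : bracket v w * dot X u - bracket u w * dot X v = det3 u v w * X 0 2.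
  have := congr1 (dot X) (cramer_bracket u v w).
  rewrite ![dot X _]dotC !dotDl !dotZl ![dot _ X]dotC Xw (bracketC u w) mulr0 addr0 mulNr => ->.
  by rewrite dot3E !row3E; ring.
set d := det3 u v w => cramer.
transitivity (d / (bracket u w * bracket v w) *
  (d * X 0 2 - (bracket v w * dot X u - bracket u w * dot X v))); last first.
  by rewrite cramer subrr mulr0.
by field; rewrite uw vw.
Qed.

Lemma touching_levelE u v w : pairwise_nonparallel u v w ->
  touching_level u v w =
    - (Num.sg (bracket u w * bracket v w) * (`|bracket u v| * area_of_lines u v w)).
Proof.
case/and3P => uv0 vw0 wu0; rewrite /touching_level /area_of_lines.
have -> : `|bracket u v * bracket v w * bracket w u| =
    `|bracket u v| * `|bracket u w * bracket v w|.
  by rewrite (bracketC u w) mulrN normrN -mulrA normrM [bracket v w * _]mulrC.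
have uw0 : bracket u w != 0 by rewrite bracketC oppr_eq0.
have {uw0 vw0 wu0} := mulf_neq0 uw0 vw0; have : `|bracket u v| != 0 by rewrite normr_eq0.
move: `|bracket u v| (_ * _) (det3 _ _ _) => a x d a0.
by case: sgrP => // x0 _; field; rewrite a0 ?(gt_eqF x0) ?(lt_eqF x0).
Qed.

End Lines.

(** * Equal areas in a family of lines *)

Section ThreeElementSets.
Variable V : finType.
Implicit Types (a b c i j k : V).

Lemma cards3 a b c : (#|[set a; b; c]| == 3)%N = uniq [:: a; b; c].
Proof.
rewrite -setUA cardsU1 cards2 /= !inE.
by case: (a == b); case: (a == c); case: (b == c).
Qed.

Lemma set3_rot a b c : [set a; b; c] = [set b; c; a].
Proof. by rewrite -setUA setUC. Qed.

Lemma set3D1 a b c : uniq [:: a; b; c] -> [set a; b; c] :\ c = [set a; b].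
Proof.
rewrite /= !inE negb_or andbT => /andP[/andP[_ ac] bc].
by rewrite setUC setU1K // !inE negb_or ![c == _]eq_sym ac.
Qed.

Lemma sum_set3 (F : V -> nat) a b c : uniq [:: a; b; c] ->
  (\sum_(x in [set a; b; c]) F x = F a + F b + F c)%N.
Proof.
rewrite /= !inE andbT => /andP[abc bc].
by rewrite -setUA big_setU1 ?inE //= big_setU1 ?inE //= big_set1 addnA.
Qed.

Lemma set3_sym_ind (Q : V -> V -> V -> Prop) a b c i j k :
  (forall x y z, Q x y z -> Q y x z) -> (forall x y z, Q x y z -> Q x z y) ->
  uniq [:: a; b; c] -> [set a; b; c] = [set i; j; k] -> Q i j k -> Q a b c.
Proof.
move=> Q12 Q23 + E Qijk.
have: a \in [set i; j; k] by rewrite -E !inE eqxx.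
have: b \in [set i; j; k] by rewrite -E !inE eqxx ?orbT.
have: c \in [set i; j; k] by rewrite -E !inE eqxx ?orbT.
rewrite !inE -!orbA => /or3P[] /eqP -> /or3P[] /eqP -> /or3P[] /eqP ->;
  rewrite /= !inE ?eqxx ?orbT ?andbF // => _; by auto.
Qed.

End ThreeElementSets.

Section PositiveNormals.
Variable R : realType.
Implicit Types (u v w : 'rV[R]_3).

(* For such normals [0 < bracket u v] compares the slopes of the lines. *)
Definition positive_normal u : bool := (0 < u 0 0) || (u 0 0 == 0) && (0 < u 0 1).

Lemma positive_normal_affine u : positive_normal u -> affine_coords u.
Proof. by case/orP => [/lt0r_neq0|/andP[_ /lt0r_neq0]]; [left | right]. Qed.

Lemma is_line_positive_normal (l : set (R * R)) : is_line l ->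
  exists2 u : 'rV[R]_3, positive_normal u & l = line_of u.
Proof.
move=> [u u_aff ->]; have [u_pos|u_npos] := boolP (positive_normal u); first by exists u.
exists (- 1 *: u); last by rewrite line_ofZ // oppr_eq0 oner_eq0.
move: u_npos u_aff; rewrite /positive_normal /affine_coords !mxE !mulN1r !oppr_gt0 oppr_eq0.
by case: ltgtP => //= _; case: ltgtP => //= _ _ [].
Qed.

Lemma positive_normal_acyclic u v w :
  positive_normal u -> positive_normal v -> positive_normal w ->
  ~ [/\ 0 < bracket u v, 0 < bracket v w & 0 < bracket w u].
Proof.
have ge0 x : positive_normal x -> 0 <= x 0 0 by case/orP => [/ltW //|/andP[/eqP ->]].
move=> /ge0 u0 /ge0 v0 /ge0 w0 [uv vw wu].
have /rowP/(_ 0) := cramer_bracket u v w; rewrite row3E !mxE => dep.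
have u00 : u 0 0 = 0 by nra.
have v00 : v 0 0 = 0 by nra.
by move: uv; rewrite /bracket u00 v00; lra.
Qed.

Lemma two_outer_lines u v w :
  positive_normal u -> positive_normal v -> positive_normal w -> pairwise_nonparallel u v w ->
  (2 <= (0 < bracket u w * bracket v w)%R + (0 < bracket v u * bracket w u)%R
        + (0 < bracket w v * bracket u v)%R)%N.
Proof.
move=> pu pv pw /and3P[uv vw wu].
rewrite (bracketC u v) (bracketC v w) (bracketC w u) !mulNr !oppr_gt0 !mulr_lt0 uv vw wu /=.
have := positive_normal_acyclic pu pv pw; have := positive_normal_acyclic pw pv pu.
rewrite (bracketC u v) (bracketC v w) (bracketC w u) !oppr_gt0 !lt0r uv vw wu /= !leNgt.
case: (bracket v w < 0); case: (bracket u v < 0); case: (bracket w u < 0) => //= not_neg not_pos.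
- by case: not_neg.
- by case: not_pos.
Qed.

End PositiveNormals.

Section LineFamilies.
Variables (R : realType) (V : finType) (u : V -> 'rV[R]_3).
Implicit Types (i j l a b : V) (T P : {set V}) (x s : R).

Definition triangle_with_area i j k x : Prop :=
  pairwise_nonparallel (u i) (u j) (u k) /\ x = area_of_lines (u i) (u j) (u k).

Definition has_area T x : Prop :=
  exists i j k, T = [set i; j; k] /\ triangle_with_area i j k x.

Definition equal_area : rel {set V} :=
  fun T T' => (T != T') && `[< exists2 x, has_area T x & has_area T' x >].

(* For positive normals, 1 or -1 according as the slope of [l] lies outside or between the two
   slopes of [P]. *)
Definition side P l : R := Num.sg (\prod_(a in P) bracket (u a) (u l)).

Lemma pairwise_nonparallel_uniq i j k : pairwise_nonparallel (u i) (u j) (u k) -> uniq [:: i; j; k].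
Proof.
have neq p q : bracket (u p) (u q) != 0 -> p != q by apply: contraNneq => ->; rewrite bracketxx.
by case/and3P => /neq ij /neq jk /neq ki; rewrite /= !inE negb_or ij jk eq_sym ki.
Qed.

Lemma has_area_card T x : has_area T x -> #|T| = 3%N.
Proof. by case=> i [j [k [-> [/pairwise_nonparallel_uniq + _]]]]; rewrite -cards3 => /eqP. Qed.

Lemma has_area_set3 i j k x : has_area [set i; j; k] x -> triangle_with_area i j k x.
Proof.
move=> /[dup]/has_area_card/eqP; rewrite cards3 => ijk [i' [j' [k' [E]]]].
apply: (set3_sym_ind (Q := fun i j k => triangle_with_area i j k x)) ijk E => a b c.
  by rewrite /triangle_with_area pairwise_nonparallelC12 area_of_linesC12.
by rewrite /triangle_with_area pairwise_nonparallelC23 area_of_linesC23.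
Qed.

Lemma has_area_setU1 a b l x : has_area (l |: [set a; b]) x -> triangle_with_area a b l x.
Proof. by rewrite setUC => /has_area_set3. Qed.

Lemma has_area_inj T x y : has_area T x -> has_area T y -> x = y.
Proof. by move=> Tx [i [j [k [E [_ ->]]]]]; move: Tx; rewrite E => /has_area_set3[]. Qed.

Lemma equal_area_sym : symmetric equal_area.
Proof.
move=> T T'; rewrite /equal_area eq_sym; congr (_ && _).
by apply/asboolP/asboolP => -[x Tx T'x]; exists x.
Qed.

Lemma equal_area_irr : irreflexive equal_area.
Proof. by move=> T; rewrite /equal_area eqxx. Qed.

Lemma equal_area_setU1 T a b l : equal_area T (l |: [set a; b]) ->
  exists2 x, has_area T x & triangle_with_area a b l x.
Proof. by case/andP=> _ /asboolP[x Tx /has_area_setU1]; exists x. Qed.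

Lemma side_pair a b l : a != b ->
  side [set a; b] l = Num.sg (bracket (u a) (u l) * bracket (u b) (u l)).
Proof. by move=> ab; rewrite /side big_setU1 ?inE // big_set1. Qed.

Section GeneralPosition.
Hypothesis u_pos : forall i, positive_normal (u i).
Hypothesis card_tangents : forall Q, is_conic Q ->
  (#|[set i | `[< tangent Q (line_of (u i)) >]]| <= 5)%N.

Lemma two_outer_in_triangle T x : has_area T x ->
  (2 <= #|[set l in T | side (T :\ l) l == 1%R]|)%N.
Proof.
case=> i [j [k [-> [ijk _]]]]; have uijk := pairwise_nonparallel_uniq ijk.
have ujki : uniq [:: j; k; i] by rewrite -(rot_uniq 2).
have ukij : uniq [:: k; i; j] by rewrite -(rot_uniq 1).
pose out l := side ([set i; j; k] :\ l) l == 1.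
have outE a b l : uniq [:: a; b; l] -> [set i; j; k] = [set a; b; l] ->
    out l = (0 < bracket (u a) (u l) * bracket (u b) (u l)).
  move=> uabl E; rewrite /out E set3D1 // side_pair ?sgr_cp0 //.
  by move: uabl; rewrite /= !inE negb_or => /andP[/andP[]].
have -> : #|[set l in [set i; j; k] | out l]| = (\sum_(l in [set i; j; k]) out l)%N.
  by rewrite -sum1dep_card big_mkcondr.
rewrite sum_set3 // (outE i j k) // (outE j k i _ (set3_rot i j k)) //.
rewrite (outE k i j _ (esym (set3_rot k i j))) //.
by rewrite addnC addnA two_outer_lines.
Qed.

Lemma card_touching_le3 a b c : bracket (u a) (u b) != 0 ->
  (#|[set l | [&& bracket (u a) (u l) != 0, bracket (u b) (u l) != 0 &
      touching_level (u a) (u b) (u l) == c]%R]| <= 3)%N.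
Proof.
move=> ab; set A := [set l | _].
have neq : a != b by apply: contraNneq ab => ->; rewrite bracketxx.
have aA : a \notin A by rewrite inE bracketxx eqxx.
have bA : b \notin A by rewrite inE bracketxx eqxx andbF.
rewrite -2!ltnS; have <- : #|a |: (b |: A)| = #|A|.+2.
  by rewrite !cardsU1 !inE !bracketxx eqxx ?andbF /= orbF neq.
apply: leq_trans (card_tangents (hyperbola_conic c ab)).
apply/subset_leq_card/subsetP => l; rewrite !inE => /or3P[/eqP ->|/eqP ->|].
- exact/asboolP/tangent_asymptote/positive_normal_affine.
- by rewrite hyperbolaC; exact/asboolP/tangent_asymptote/positive_normal_affine.
- case/and3P => al bl /eqP <-.
  by apply/asboolP/tangent_hyperbola => //; exact: positive_normal_affine.
Qed.

Lemma card_equal_area_side_le3 T P s : #|P| = 2%N ->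
  (#|[set l | equal_area T (l |: P) && (side P l == s)]| <= 3)%N.
Proof.
move=> /eqP/cards2P[a [b [ab ->]]]; set A := [set l | _].
have [->|[l0]] := set_0Vmem A; first by rewrite cards0.
rewrite inE => /andP[/equal_area_setU1[x Tx [/and3P[ab0 _ _] _]] _].
apply: leq_trans (card_touching_le3 (- (s * (`|bracket (u a) (u b)| * x))) ab0).
apply/subset_leq_card/subsetP => l; rewrite !inE side_pair //.
case/andP => /equal_area_setU1[y Ty [abl ey]] /eqP <-.
rewrite (has_area_inj Tx Ty) ey -touching_levelE // eqxx andbT.
by case/and3P: abl => _ -> la; rewrite bracketC oppr_eq0 la.
Qed.

Lemma card_equal_area_pair_le6 T P : #|P| = 2%N -> (#|[set l | equal_area T (l |: P)]| <= 6)%N.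
Proof.
move=> P2; have le3 s := card_equal_area_side_le3 T s P2.
apply: leq_trans (leq_add (le3 1) (le3 (- 1))).
apply: leq_trans (leq_card_setU _ _); apply/subset_leq_card/subsetP => l.
rewrite !inE => Tl; rewrite Tl /=; move/eqP/cards2P: P2 Tl => [a [b [ab ->]]].
case/equal_area_setU1 => x _ [/and3P[_ bl la] _]; rewrite side_pair //.
case: sgrP => [/eqP|_|_]; rewrite ?eqxx ?orbT //.
by rewrite mulf_eq0 (negPf bl) (bracketC (u l)) oppr_eq0 (negPf la).
Qed.

Lemma large_equal_area_free_set (N : nat) : (N < #|V|)%N -> (N ^ 5 <= #|V|)%N ->
  exists2 S : {set V}, #|S| = N.+1 & conflict_free equal_area S.
Proof.
move=> NV N5V; have [m mV lt_N] := exists_sample_size NV N5V.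
have [|||S free_S le_S] := @large_conflict_free_set V equal_area (fun P l => side P l == 1) 3 6
    equal_area_sym equal_area_irr _ _ _ card_equal_area_pair_le6 m mV.
- by move=> T T' /andP[_ /asboolP[x _ /has_area_card]].
- by move=> T T' /andP[_ /asboolP[x _ /two_outer_in_triangle]].
- by move=> T P; exact: card_equal_area_side_le3.
have /exists_subset_card[S' S'S cS'] : (N < #|S|)%N.
  by rewrite -(ltr_nat rat) (lt_le_trans lt_N).
by exists S' => // T T' TS' T'S'; apply: free_S; apply: subset_trans S'S.
Qed.

End GeneralPosition.
End LineFamilies.

Lemma conflict_free_distinct_areas (R : realType) (n : nat) (u : 'I_n -> 'rV[R]_3)
    (S : {set 'I_n}) :
  (forall i, affine_coords (u i)) -> conflict_free (equal_area u) S ->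
  distinct_areas (fun i => line_of (u i)) S.
Proof.
move=> u_aff free_S i j k i' j' k' a a' iS jS kS i'S j'S k'S.
move=> /triangle_area_of_lines-/(_ (u_aff _) (u_aff _) (u_aff _)) ijk.
move=> /triangle_area_of_lines-/(_ (u_aff _) (u_aff _) (u_aff _)) ijk' neq.
have sub p q r : p \in S -> q \in S -> r \in S -> [set p; q; r] \subset S.
  by move=> pS qS rS; rewrite !subUset !sub1set pS qS.
apply: contraNneq (free_S _ _ (sub _ _ _ iS jS kS) (sub _ _ _ i'S j'S k'S)) => aa'.
apply/andP; split=> //; apply/asboolP; exists a; first by exists i, j, k.
by exists i', j', k'; rewrite aa'.
Qed.

Lemma card_tangents_le5 (R : realType) (n : nat) (L : 'I_n -> set (R * R))
    (Q : 'M[R]_3) :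
  no_six_cotangent L -> is_conic Q -> (#|[set i | `[< tangent Q (L i) >]]| <= 5)%N.
Proof.
move=> no6 conicQ; rewrite leqNgt; apply/negP => /exists_subset_card[S /subsetP SQ S6].
by apply: no6 S6 _; exists Q => // i /SQ; rewrite inE => /asboolP.
Qed.

Lemma guaranteed_fifth_root (R : realType) (n N : nat) :
  (N < n)%N -> (N ^ 5 <= n)%N -> guaranteed R n N.+1.
Proof.
move=> Nn N5n L [_ lines] no6.
have /choice[u uP] i : exists v : 'rV[R]_3, positive_normal v /\ L i = line_of v.
  by have [v v_pos ->] := is_line_positive_normal (lines i); exists v.
have u_pos i : positive_normal (u i) by case: (uP i).
have eL : L = fun i => line_of (u i) by apply/funext => i; case: (uP i).
rewrite eL in no6 *.
have le5 Q (conicQ : is_conic Q) := card_tangents_le5 no6 conicQ.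
have [||S cS free_S] := large_equal_area_free_set u_pos le5 (N := N); rewrite ?card_ord //.
exists S; split=> //; apply: conflict_free_distinct_areas => // i.
exact: positive_normal_affine.
Qed.

(** * An arrangement in general position *)

Lemma det2_eq0_of_kernel (F : idomainType) (a b c d p q : F) : (p != 0) || (q != 0) ->
  p * a + q * c = 0 -> p * b + q * d = 0 -> a * d - b * c = 0.
Proof.
move=> pq0 ac bd; case/orP: pq0 => nz; apply: (mulfI nz); rewrite mulr0.
  transitivity ((p * a + q * c) * d - (p * b + q * d) * c); first by ring.
  by rewrite ac bd !mul0r subrr.
transitivity ((p * b + q * d) * a - (p * a + q * c) * b); first by ring.
by rewrite ac bd !mul0r subrr.
Qed.

(* Otherwise the coefficient below the leading one would be minus the leading one times the sum of
   the roots. *)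
Lemma poly_eq0_of_positive_roots (R : realFieldType) (p : {poly R}) (rs : seq R) :
  (0 < size rs)%N -> (size p <= (size rs).+1)%N -> p`_(size rs).-1 = 0 ->
  uniq rs -> all (root p) rs -> (forall x, x \in rs -> 0 < x) -> p = 0.
Proof.
move=> rs0 le_p p_sub u_rs rt_rs pos; apply/eqP/negPn/negP => p0.
have size_p : size p = (size rs).+1.
  by apply/eqP; rewrite eqn_leq le_p max_poly_roots.
have rs_uniq_roots : uniq_roots rs by rewrite uniq_rootsE.
have := all_roots_prod_XsubC size_p rt_rs rs_uniq_roots.
move/(congr1 (fun q : {poly R} => q`_(size rs).-1)).
rewrite /= p_sub coefZ coefPn_prod_XsubC -?lt0n // => /esym/eqP.
rewrite mulf_eq0 lead_coef_eq0 (negPf p0) oppr_eq0 /=; apply/negP/lt0r_neq0.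
case: rs rs0 pos {le_p p_sub u_rs rt_rs size_p rs_uniq_roots} => // x rs _ pos.
rewrite big_cons ltr_pwDl ?pos ?mem_head // big_seq sumr_ge0 // => y y_rs.
by rewrite ltW ?pos // inE y_rs orbT.
Qed.

Section CubicArrangement.
Variable R : realType.
Implicit Types (Q : 'M[R]_3) (t : R).

Definition cubic_line t : 'rV[R]_3 := row3 1 t (t ^+ 3).

Lemma cubic_line_affine t : affine_coords (cubic_line t).
Proof. by left; rewrite row3E oner_neq0. Qed.

Lemma cubic_line_inj t t' : line_of (cubic_line t) = line_of (cubic_line t') -> t = t'.
Proof.
move=> /(line_of_eq_scale (cubic_line_affine t))[c /rowP E].
by have := (E 0, E 1); rewrite !mxE /= mulr1 => -[<-]; rewrite mul1r.
Qed.

(* The value at [u = (1, t, t^3)] of the dual conic [u *m \adj Q *m u^T]. *)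
Definition dual_poly Q : {poly R} :=
  Poly [:: minor2 Q 1 2 1 2; 2 * minor2 Q 1 2 2 0; minor2 Q 2 0 2 0;
           2 * minor2 Q 1 2 0 1; 2 * minor2 Q 2 0 0 1; 0; minor2 Q 0 1 0 1].

Lemma dual_poly_gram Q t (X := row3 (- t) 1 0) (Y := row3 (- t ^+ 3) 0 1) : Q^T = Q ->
  (dual_poly Q).[t] =
    dot (X *m Q) X * dot (Y *m Q) Y - dot (Y *m Q) X * dot (X *m Q) Y.
Proof.
move=> Q_sym; have s i j : Q j i = Q i j by rewrite -{1}Q_sym mxE.
rewrite /dual_poly horner_Poly /= /minor2 !dot3E !mxE !big_ord3 !mxE /= (s 0 1) (s 0 2) (s 1 2).
ring.
Qed.

(* On a tangent line the conic restricts to a binary quadratic form with the contact point in its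
   kernel. *)
Lemma tangent_cubic_line_root Q t :
  Q^T = Q -> tangent Q (line_of (cubic_line t)) -> root (dual_poly Q) t.
Proof.
move=> Q_sym /(tangentP _ (cubic_line_affine t))[P [P0 Pt polarP]].
pose X : 'rV[R]_3 := row3 (- t) 1 0; pose Y : 'rV[R]_3 := row3 (- t ^+ 3) 0 1.
have PE : P = P 0 1 *: X + P 0 2 *: Y.
  by move: Pt; rewrite dot3E !row3E => Pt; apply: eq_row3; rewrite !mxE /=; lra.
have dotP Z : dot Z P = P 0 1 * dot Z X + P 0 2 * dot Z Y.
  by rewrite {1}PE !(dotC Z) dotDl !dotZl.
apply/rootP; rewrite dual_poly_gram //; apply: (@det2_eq0_of_kernel _ _ _ _ _ (P 0 1) (P 0 2)).
- apply: contraNT P0; rewrite negb_or !negbK => /andP[/eqP P1 /eqP P2].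
  by rewrite PE P1 P2 !scale0r addr0.
- by rewrite -dotP polarP // dot3E !row3E; ring.
- by rewrite -dotP polarP // dot3E !row3E; ring.
Qed.

Lemma dual_poly_eq0_rank Q : Q^T = Q -> dual_poly Q = 0 -> (\rank Q <= 1)%N.
Proof.
move=> Q_sym Q0; have s i j : Q j i = Q i j by rewrite -{1}Q_sym mxE.
have coef k : (dual_poly Q)`_k = 0 by rewrite Q0 coef0.
have := (coef 0, coef 1, coef 2, coef 3, coef 4, coef 6).
rewrite /dual_poly !coef_Poly /= /minor2 (s 0 1) (s 0 2) (s 1 2) => -[[[[[c0 c1] c2] c3] c4] c6].
apply/mxrank_le1P => i j k l; rewrite /minor2.
by case: (ord3P i) => ->; case: (ord3P j) => ->; case: (ord3P k) => ->; case: (ord3P l) => ->;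
  rewrite ?(s 0 1) ?(s 0 2) ?(s 1 2); lra.
Qed.

Definition cubic_arrangement n (i : 'I_n) : set (R * R) := line_of (cubic_line i.+1%:R).

Lemma cubic_line_arrangement n : line_arrangement (@cubic_arrangement n).
Proof.
split=> [i j /cubic_line_inj/eqP|i]; last first.
  by exists (cubic_line i.+1%:R) => //; exact: cubic_line_affine.
by rewrite eqr_nat => /eqP[] /val_inj.
Qed.

Lemma cubic_no_six_cotangent n : no_six_cotangent (@cubic_arrangement n).
Proof.
move=> S S6 [Q [Q_sym rkQ] tanQ].
suff /(dual_poly_eq0_rank Q_sym) : dual_poly Q = 0 by rewrite leqNgt rkQ.
have size_S : size (enum S) = 6%N by rewrite -cardE.
apply: (@poly_eq0_of_positive_roots _ _ [seq i.+1%:R | i : 'I_n <- enum S]);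
  rewrite ?size_map ?size_S //.
- exact: size_Poly.
- by rewrite coef_Poly.
- rewrite map_inj_uniq ?enum_uniq // => i j /eqP; rewrite eqr_nat => /eqP[].
  exact: val_inj.
- apply/allP => x /mapP[i]; rewrite mem_enum => iS ->.
  exact: tangent_cubic_line_root Q_sym (tanQ i iS).
- by move=> x /mapP[i _ ->]; rewrite ltr0n.
Qed.

Lemma guaranteed_le n d : guaranteed R n d -> (d <= n)%N.
Proof.
move/(_ _ (cubic_line_arrangement n) (@cubic_no_six_cotangent n)) => [S [<- _]].
by rewrite -[leqRHS]card_ord max_card.
Qed.

End CubicArrangement.

Lemma is_largest_xget (A : set nat) (b d : nat) : A d -> (forall d', A d' -> (d' <= b)%N) ->
  is_largest A (xget 0%N [set d | is_largest A d]%classic).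
Proof.
move=> Ad leb; apply: (xgetPex 0%N).
have ex : exists d', `[< A d' >] by exists d; apply/asboolP.
have ub d' : `[< A d' >] -> (d' <= b)%N by move/asboolP/leb.
case: (ex_maxnP ex ub) => m /asboolP Am max_m.
by exists m; split=> // d' Ad'; apply/max_m/asboolP.
Qed.

Lemma guaranteed_le_D (R : realType) (n d : nat) : guaranteed R n d -> (d <= D R n)%N.
Proof.
move=> gd; case: (is_largest_xget gd (@guaranteed_le R n)) => _; exact.
Qed.

Theorem theorem4 (R : realType) (n : nat) (hn : (2 <= n)%N) :
  (n%:R : R) `^ (5%:R^-1) < (D R n)%:R.
Proof.
set x := _ `^ _; pose N := Num.truncn x.
have x0 : 0 <= x by exact: powR_ge0.
have x5 : x ^+ 5 = n%:R by rewrite -powR_mulrn // -powRrM mulVf ?pnatr_eq0 // powRr1.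
have N5n : (N ^ 5 <= n)%N.
  by rewrite -(ler_nat R) natrX -x5 lerXn2r ?nnegrE ?ler0n ?truncn_le.
have Nn : (N < n)%N.
  have [N1|N2] := leqP N 1; first exact: leq_trans hn.
  by apply: leq_trans N5n; rewrite -{1}(expn1 N) ltn_exp2l.
have ND := guaranteed_le_D (guaranteed_fifth_root Nn N5n).
by apply: lt_le_trans (truncnS_gt x) _; rewrite ler_nat.
Qed.
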